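(* For every $1\le\delta<2$ we have $\alpha_{\star}(\delta,1)=\delta$.
   Context: All logarithms are in base $2$. $G_{n,\frac12}$ denotes the random graph on vertex set $V=\{1,\dots,n\}$ in which each of the $\binom n2$ pairs of vertices is an edge independently with probability $\frac12$. Probe model with $\ell$ rounds. An algorithm has unbounded computation time and accesses the input graph $G$ only by probes; a probe of a pair $(i,j)$, $1\le i<j\le n$, reveals whether $(i,j)$ is an edge of $G$. The algorithm proceeds in $\ell$ rounds: in round $1$ it selects a set $E_1$ of pairs and the status (edge or non-edge) of all pairs in $E_1$ is revealed; for $2 \le i\le \ell$, in round $i$ it selects a set $E_i$ of pairs, depending on the outcomes of the probes in rounds $1,\dots,i-1$, and the status of all pairs in $E_i$ is revealed. All probes of one round are done in parallel. After round $\ell$ the algorithm outputs a set of vertices, which it has to ensure is a clique of $G$. The total number of probes is $\sum_{i=1}^{\ell}|E_i|$. $\alpha_{\star}(\delta,\ell)$ is the supremum over all $\alpha$ such that there exists an algorithm (one for each $n$) that, on a graph drawn at random from $G_{n,\frac12}$, probes at most $n^{\delta}$ entries of the adjacency matrix, with the probes being done in $\ell$ rounds, and outputs a clique of size at least $\alpha\log n$ with probability at least $\frac12$, for all sufficiently large $n$. *)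

(* Defs.v *)
From HB Require Import structures.
From mathcomp Require Import all_boot all_order all_algebra.
From mathcomp Require Import all_classical all_reals all_analysis.

Set Implicit Arguments.
Unset Strict Implicit.
Unset Printing Implicit Defensive.

Import Order.TTheory GRing.Theory Num.Theory.
Import numFieldNormedType.Exports.

Local Open Scope classical_set_scope.
Local Open Scope ring_scope.

Definition log2 (R : realType) (x : R) : R := ln x / ln 2.

(* The unordered pairs of vertices of the vertex set 'I_n, each represented
   once, by its increasing enumeration. *)
Definition vpair (n : nat) : finType :=
  {e : 'I_n * 'I_n | (e.1 < e.2)%N}.

(* A graph on 'I_n is given by its set of edges. *)
Definition graph (n : nat) : finType := {set vpair n}.

Definition is_clique (n : nat) (G : graph n) (C : {set 'I_n}) : bool :=
  [forall e : vpair n,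
    ((val e).1 \in C) && ((val e).2 \in C) ==> (e \in G)].

(* The law of the random graph in which the pairs are edges independently,
   each with probability p. *)
Definition gnp_weight (R : realType) (n : nat) (p : R) (G : graph n) : R :=
  \prod_(e : vpair n) (if e \in G then p else 1 - p).

Definition gnp_Pr (R : realType) (n : nat) (p : R) (A : pred (graph n)) : R :=
  \sum_(G : graph n | A G) gnp_weight p G.

(* One round of probes: the set of probed pairs, and the set of those which
   turned out to be edges. *)
Definition round (n : nat) : Type := ({set vpair n} * {set vpair n})%type.

(* An algorithm sees nothing of the input graph but the rounds already played,
   listed in chronological order. *)
Record algorithm (n : nat) := Algorithm {
  select : seq (round n) -> {set vpair n};
  output : seq (round n) -> {set 'I_n} }.

Fixpoint transcript (n : nat) (A : algorithm n) (G : graph n) (l : nat) :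
    seq (round n) :=
  if l is l'.+1 then
    let h := transcript A G l' in
    let E := select A h in
    rcons h (E, E :&: G)
  else [::].

Definition result (n : nat) (A : algorithm n) (l : nat) (G : graph n) :
    {set 'I_n} := output A (transcript A G l).

Definition num_probes (n : nat) (A : algorithm n) (l : nat) (G : graph n) :
    nat := (\sum_(r <- transcript A G l) #|r.1|)%N.

(* The output has to be a clique on every input graph, not merely with high
   probability. *)
Definition ensures_clique (n : nat) (A : algorithm n) (l : nat) : Prop :=
  forall G : graph n, is_clique G (result A l G).

Definition achievable (R : realType) (delta : R) (l : nat) (alpha : R) : Prop :=
  exists A : forall n : nat, algorithm n,
    (forall n, ensures_clique (A n) l) /\
    \forall n \near \oo,
      (forall G : graph n, (num_probes (A n) l G)%:R <= n%:R `^ delta) /\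
      1 / 2 <= gnp_Pr (1 / 2 : R)
        (fun G : graph n => alpha * log2 (n%:R : R) <= #|result (A n) l G|%:R).

(* The supremum is taken in the extended reals, where it exists without any
   boundedness condition. *)
Definition alpha_star (R : realType) (delta : R) (l : nat) : \bar R :=
  ereal_sup [set alpha%:E | alpha in [set a : R | achievable delta l a]].

(* Main.v *)
Require Import Defs.
From mathcomp Require Import all_boot all_order all_algebra.
From mathcomp Require Import all_classical all_reals all_analysis.
From mathcomp Require Import ring lra zify.

Set Implicit Arguments.
Unset Strict Implicit.
Unset Printing Implicit Defensive.

Import Order.TTheory GRing.Theory Num.Theory.

Local Open Scope ring_scope.

(** With a single round, an algorithm fixes a set [E] of at most [n ^ delta]
    pairs before it sees anything, and the question is how large a clique the
    random graph restricted to [E] contains.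

    Upper bound.  The output consists of probed pairs only: otherwise, deleting
    from the graph an unprobed pair inside the output would change nothing that
    the algorithm sees and would falsify the output ([is_clique_probed]).  A
    graph with [m] edges has at most [m ^ t] cliques on [2t] vertices, since
    such a clique is covered by [t] of its edges ([card_cliques]).  Each one
    survives in the random graph with probability [2 ^ (- t (2t - 1))], so a
    clique of size [2t] appears with probability at most
    [(m / 2 ^ (2t - 1)) ^ t] ([Pr_clique_upper]).  When [2t] is within [2] of
    [alpha * log n] with [alpha > delta], the base of this power is
    [O(n ^ (delta - alpha))], which tends to [0] ([not_achievable]).

    Lower bound.  Probe all pairs inside a set of about [n ^ (delta / 2)]
    vertices; one needs a clique of size [alpha * log n] there, for
    [alpha < delta].  The second moment method becomes short when it is applied
    only to transversals of a partition of the vertices into [k = 2t + 1] blocks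
    of size [b].  If two transversals [f] and [g] agree on [a] blocks, the
    correlation between them is [2 ^ 'C(a, 2) <= (2 ^ t) ^ a], because
    [a <= 2t + 1], and this bound is a product over the blocks.  Hence the
    second moment of the number of transversal cliques is at most
    [(1 + 2 ^ t / b) ^ k] times the square of the mean, which is close to [1] as
    soon as [b] is a large multiple of [k * 2 ^ t] ([Pr_transversal]).  The
    number of vertices used is then [k * b = O(k ^ 2 * 2 ^ t)], which is
    [n ^ (alpha / 2)] up to a polylogarithmic factor, and so less than
    [n ^ (delta / 2)] ([achievable_lt]). *)

(** * Pairs inside a vertex set *)

Definition pairs_in (n : nat) (C : {set 'I_n}) : {set vpair n} :=
  [set e | ((val e).1 \in C) && ((val e).2 \in C)].

Lemma is_cliqueE n (G : graph n) C : is_clique G C = (pairs_in C \subset G).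
Proof.
apply/forallP/fintype.subsetP => H e.
  by rewrite inE => ?; move: (H e) => /implyP; apply.
by apply/implyP => ?; apply: H; rewrite inE.
Qed.

Lemma pairs_inI n (C D : {set 'I_n}) :
  pairs_in (C :&: D) = pairs_in C :&: pairs_in D.
Proof. by apply/setP => e; rewrite !inE andbACA. Qed.

Lemma pairs_inS n (C D : {set 'I_n}) :
  C \subset D -> pairs_in C \subset pairs_in D.
Proof.
move=> /fintype.subsetP CD; apply/fintype.subsetP => e.
by rewrite !inE => /andP[/CD -> /CD ->].
Qed.

Lemma exists_vpair n (x y : 'I_n) :
  x != y -> exists e : vpair n, [set (val e).1; (val e).2] = [set x; y].
Proof.
move=> xy; case: (ltngtP x y) => [lt|lt|/val_inj eq].
- by exists (exist _ (x, y) lt).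
- by exists (exist _ (y, x) lt); rewrite finset.setUC.
- by rewrite eq eqxx in xy.
Qed.

(** Sending a pair to the set of its two ends is a bijection onto the
    two-element subsets of [C]. *)
Lemma card_pairs_in n (C : {set 'I_n}) : #|pairs_in C| = 'C(#|C|, 2).
Proof.
rewrite -cards_draws.
pose ends (e : vpair n) := [set (val e).1; (val e).2].
have ends_inj : injective ends.
  move=> [[a b] /= ab] [[c d] /= cd] /setP E; apply/val_inj => /=.
  have [] := (E a, E b); rewrite /ends !inE /= !eqxx /= orbT => Ea Eb.
  move: (esym Ea) (esym Eb) => /orP[]/eqP ? /orP[]/eqP ?; subst => //; lia.
rewrite -(card_imset _ ends_inj); apply: eq_card => B; rewrite inE.
apply/imsetP/andP => [[e]|[BC /cards2P[x [y [xy BE]]]]].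
  rewrite inE => /andP[e1 e2] ->; split.
    by apply/fintype.subsetP => z; rewrite !inE => /orP[]/eqP ->.
  by rewrite cards2 neq_ltn (valP e).
have [e eE] := exists_vpair xy; exists e; last by rewrite BE -eE.
have /fintype.subsetP sub : ends e \subset C by rewrite /ends eE -BE.
by rewrite inE !sub // !inE eqxx ?orbT.
Qed.

(** * Probabilities in the random graph *)

Lemma gnp_weight_ge0 (R : realType) n (p : R) (G : graph n) :
  0 <= p <= 1 -> 0 <= gnp_weight p G.
Proof.
move=> /andP[p0 p1]; apply: prodr_ge0 => e _.
by case: ifP => _ //; rewrite subr_ge0.
Qed.

(** Giving weight [0] to the absence of a pair of [S] discards the graphs that
    do not contain [S]; the sum of these modified weights is the expansion of a
    product over the pairs, with factor [p] on [S] and [p + (1 - p)] elsewhere.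
*)
Lemma gnp_Pr_supset (R : realType) n (p : R) (S : {set vpair n}) :
  gnp_Pr p (fun G => S \subset G) = p ^+ #|S|.
Proof.
have -> : p ^+ #|S| =
    \prod_(e : vpair n) (p + (if e \in S then 0 else 1 - p)).
  rewrite -prodr_const big_mkcond /=; apply: eq_bigr => e _.
  by case: ifP => _; rewrite ?addr0 // addrC subrK.
rewrite bigA_distr /gnp_Pr big_mkcond /=; apply: eq_bigr => G _.
case: ifP => [/fintype.subsetP SG|/negbT/subsetPn[e eS eG]].
  apply: eq_bigr => e _; case: ifPn => // eG.
  by rewrite ifN //; apply: contra eG; exact: SG.
by rewrite (bigD1 e) //= (negbTE eG) eS mul0r.
Qed.

Lemma gnp_Pr_mono (R : realType) n (p : R) (A B : pred (graph n)) :
  0 <= p <= 1 -> (forall G, A G -> B G) -> gnp_Pr p A <= gnp_Pr p B.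
Proof.
move=> p01 AB; rewrite /gnp_Pr [leLHS]big_mkcond [leRHS]big_mkcond /=.
apply: ler_sum => G _; case: ifP => [/AB ->|_] //.
by case: ifP => // _; exact: gnp_weight_ge0.
Qed.

Lemma gnp_Pr_union (R : realType) n (p : R) (I : finType) (K : {set I})
    (A : I -> pred (graph n)) :
  0 <= p <= 1 ->
  gnp_Pr p (fun G => [exists i in K, A i G]) <= \sum_(i in K) gnp_Pr p (A i).
Proof.
move=> p01; rewrite /gnp_Pr big_mkcond /=.
under [leRHS]eq_bigr do rewrite big_mkcond /=.
rewrite exchange_big /=; apply: ler_sum => G _.
have ge0 i : 0 <= (if A i G then gnp_weight p G else 0).
  by case: ifP => _ //; exact: gnp_weight_ge0.
case: ifP => [/existsP[i /andP[iK AiG]]|_]; last by apply: sumr_ge0.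
by rewrite (bigD1 i) //= AiG lerDl sumr_ge0.
Qed.

(** Summation of the pointwise inequality
    [mu ^+ 2 * (x != 0)%:R >= 2 * mu * x - x ^+ 2], which for [x != 0] says that
    [(mu - x) ^+ 2] is nonnegative.  It does the work of the Cauchy-Schwarz
    bound [Pr (X != 0) >= (E X) ^ 2 / E (X ^ 2)] and is as good when the second
    moment is close to [mu ^+ 2] and [mu] is the mean. *)
Lemma gnp_second_moment (R : realType) n (p mu : R) (X : graph n -> R) :
  0 <= p <= 1 ->
  2 * mu * (\sum_G gnp_weight p G * X G)
    - \sum_G gnp_weight p G * X G ^+ 2
  <= mu ^+ 2 * gnp_Pr p (fun G => X G != 0).
Proof.
move=> p01; rewrite /gnp_Pr !mulr_sumr -sumrB [leRHS]big_mkcond /=.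
apply: ler_sum => G _; have w0 := gnp_weight_ge0 G p01.
case: eqP => [->|_] /=; first by rewrite expr0n /= !mulr0 subr0.
rewrite -subr_ge0 (_ : _ - _ = gnp_weight p G * (mu - X G) ^+ 2); last by ring.
by rewrite mulr_ge0 // sqr_ge0.
Qed.

(** * Few cliques among few pairs *)

Definition cliques (n : nat) (E : graph n) (k : nat) : {set {set 'I_n}} :=
  [set D | is_clique E D & #|D| == k].

(** Removing two vertices from a clique on [2t + 2] vertices leaves a clique on
    [2t] vertices, and the removed vertices are the ends of an edge: one more
    factor [#|E|]. *)
Lemma card_cliques n (E : graph n) t : (#|cliques E t.*2| <= #|E| ^ t)%N.
Proof.
elim: t => [|t IHt].
  rewrite expn0 -(cards1 (@finset.set0 'I_n)); apply: subset_leq_card.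
  by apply/fintype.subsetP => D; rewrite !inE cards_eq0 => /andP[_].
pose add (D : {set 'I_n}) (e : vpair n) := D :|: [set (val e).1; (val e).2].
have sub : cliques E t.+1.*2 \subset
    [set add D e | D in cliques E t.*2, e in E].
  apply/fintype.subsetP => D; rewrite inE is_cliqueE => /andP[DE /eqP Dk].
  have /card_gt1P[x [y [xD yD xy]]] : (1 < #|D|)%N by rewrite Dk doubleS.
  have [e eE] := exists_vpair xy.
  have xyD : [set x; y] \subset D.
    by apply/fintype.subsetP => z; rewrite !inE => /orP[]/eqP ->.
  apply/imset2P; exists (D :\: [set x; y])%SET e.
  - rewrite inE is_cliqueE.
    rewrite (fintype.subset_trans (pairs_inS (finset.subsetDl _ _)) DE) /=.
    by rewrite cardsD (finset.setIidPr xyD) cards2 xy Dk doubleS -addn2 addnK.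
  - move/fintype.subsetP: DE; apply; rewrite inE.
    by rewrite !(fintype.subsetP xyD) // -eE !inE eqxx ?orbT.
  - by rewrite /add eE finset.setUC -{1}(finset.setIidPr xyD) finset.setID.
apply: leq_trans (subset_leq_card sub) _; rewrite expnSr.
apply: leq_trans (_ : _ <= #|cliques E t.*2| * #|E|)%N _.
  by rewrite -cardsX curry_imset2X; exact: leq_imset_card.
by rewrite leq_mul2r IHt orbT.
Qed.

(** Deleting an unprobed pair [e] from [G] leaves the transcript, hence the
    output, unchanged; so the output, a clique of [G :\ e], does not contain
    both ends of [e]. *)
Lemma is_clique_probed n (A : algorithm n) (G : graph n) :
  ensures_clique A 1 -> is_clique (select A [::] :&: G) (result A 1 G).
Proof.
move=> sureA; rewrite is_cliqueE; apply/fintype.subsetP => e eC.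
rewrite inE; apply/andP; split; last first.
  by have := sureA G; rewrite is_cliqueE => /fintype.subsetP; apply.
apply: contraT => eE.
have same : result A 1 (G :\ e) = result A 1 G.
  rewrite /result /=; congr (output A [:: (_, _)]).
  apply/setP => f; rewrite !inE; case: eqP => [->|] //=.
  by rewrite (negbTE eE).
have := sureA (G :\ e); rewrite same is_cliqueE => /fintype.subsetP/(_ e eC).
by rewrite !inE eqxx.
Qed.

Lemma num_probes1 n (A : algorithm n) (G : graph n) :
  num_probes A 1 G = #|select A [::]|.
Proof. by rewrite /num_probes /= big_seq1. Qed.

(** Union bound over the cliques of [E] on [2t] vertices. *)
Lemma Pr_clique_upper (R : realType) n (p : R) (E : graph n) t :
  0 <= p <= 1 ->
  gnp_Pr p (fun G => [exists C : {set 'I_n},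
      is_clique (E :&: G) C && (t.*2 <= #|C|)%N])
  <= #|E|%:R ^+ t * p ^+ 'C(t.*2, 2).
Proof.
move=> p01.
apply: (@le_trans _ _ (gnp_Pr p
    (fun G => [exists D in cliques E t.*2, pairs_in D \subset G]))).
  apply: gnp_Pr_mono => // G /existsP[C /andP[]].
  rewrite is_cliqueE finset.subsetI => /andP[CE CG] tC.
  (* Some subset of C has exactly 2t elements. *)
  have : (0 < #|[set D : {set 'I_n} | D \subset C & #|D| == t.*2]|)%N.
    by rewrite cards_draws bin_gt0.
  move=> /card_gt0P[D]; rewrite inE => /andP[/pairs_inS DC Dk].
  apply/existsP; exists D; rewrite inE Dk is_cliqueE.
  by rewrite !(fintype.subset_trans DC).
apply: le_trans (gnp_Pr_union _ _ p01) _.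
under eq_bigr => D.
  rewrite inE => /andP[_ /eqP Dk].
  rewrite (gnp_Pr_supset p (pairs_in D)) card_pairs_in Dk.
  over.
rewrite sumr_const -[leLHS]mulr_natl ler_wpM2r //.
  by rewrite exprn_ge0 //; case/andP: p01.
by rewrite -natrX ler_nat card_cliques.
Qed.

Lemma half01 (R : realType) : 0 <= (1 / 2 : R) <= 1.
Proof. by lra. Qed.

(** The bound of [Pr_clique_upper] is the [t]-th power of [#|E| / 2 ^ (2t - 1)],
    which is at most [8 / 32] here. *)
Lemma Pr_clique_upper_half (R : realType) n (E : graph n) t :
  (0 < t)%N -> #|E|%:R * 32 <= 2 ^+ t.*2.+2 :> R ->
  gnp_Pr (1 / 2 : R) (fun G => [exists C : {set 'I_n},
      is_clique (E :&: G) C && (t.*2 <= #|C|)%N]) <= 1 / 4.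
Proof.
move=> t0 few; apply: le_trans (Pr_clique_upper _ _ (half01 R)) _.
have -> : 'C(t.*2, 2) = (t.*2.-1 * t)%N.
  by rewrite bin2 -doubleMl doubleK mulnC.
rewrite exprM -exprMn.
set x : R := (X in X ^+ t).
have x0 : 0 <= x by rewrite mulr_ge0 // exprn_ge0.
have x4 : x <= 1 / 4.
  have p8 : (1 / 2) ^+ t.*2.-1 * 2 ^+ t.*2.+2 = 8 :> R.
    rewrite -[in X in _ * X](prednK (_ : 0 < t.*2)%N) ?double_gt0 // !exprS.
    transitivity ((1 / 2 * 2) ^+ t.*2.-1 * 8 : R).
      by rewrite [in RHS]exprMn; ring.
    by rewrite divfK // expr1n mul1r.
  have e0 : 0 < 2 ^+ t.*2.+2 :> R by rewrite exprn_gt0.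
  rewrite -(ler_pM2r e0) /x -mulrA p8.
  by move: (2 ^+ _) few => y few; lra.
apply: (le_trans _ x4); rewrite -[leRHS]expr1; apply: ler_wiXn2l => //.
by apply: (le_trans x4); lra.
Qed.

(** * Cliques among the transversals of a partition *)

(** [phi (i, y)] is the [y]-th vertex of the [i]-th block. *)
Definition transversal n k b (phi : 'I_k * 'I_b -> 'I_n)
    (f : {ffun 'I_k -> 'I_b}) : {set 'I_n} := [set phi (i, f i) | i : 'I_k].

Lemma card_transversal n k b (phi : 'I_k * 'I_b -> 'I_n) f :
  injective phi -> #|transversal phi f| = k.
Proof.
by move=> phi_inj; rewrite card_imset ?card_ord // => i j /phi_inj [].
Qed.

Lemma card_transversalI n k b (phi : 'I_k * 'I_b -> 'I_n) f g :
  injective phi ->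
  #|transversal phi f :&: transversal phi g| = #|[set i | f i == g i]|.
Proof.
move=> phi_inj; rewrite -(@card_imset _ _ (fun i => phi (i, f i))); last first.
  by move=> i j /phi_inj [].
apply: eq_card => v; rewrite inE; apply/andP/imsetP.
  move=> [/imsetP[i _ ->] /imsetP[j _ /phi_inj[<- fg]]].
  by exists i => //; rewrite inE fg.
move=> [i]; rewrite inE => /eqP fg ->.
by split; apply/imsetP; exists i; rewrite -?fg.
Qed.

(** This linearization of ['C(a, 2)] is what turns the correlation of two
    transversals into a product over the blocks. *)
Lemma bin2_half_le t a : (a <= t.*2.+1)%N -> ('C(a, 2) <= t * a)%N.
Proof.
move=> at2; rewrite bin2 -(@leq_double) -mul2n -[leqRHS]mul2n.
have := odd_double_half (a * a.-1); rewrite -[(_./2).*2]mul2n; nia.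
Qed.

(** The summand is the product over the blocks of [x] or [1], according to
    whether [f] and [g] agree there, so the sum factors: in each block there are
    [b] choices for [f], and given it one choice for [g] of weight [x] and
    [b - 1] of weight [1]. *)
Lemma sum_agree (R : realType) k b (x : R) :
  \sum_(f : {ffun 'I_k -> 'I_b}) \sum_(g : {ffun 'I_k -> 'I_b})
     x ^+ #|[set i | f i == g i]|
  = (b%:R * (b%:R - 1 + x)) ^+ k.
Proof.
have inner f : \sum_(g : {ffun 'I_k -> 'I_b}) x ^+ #|[set i | f i == g i]|
    = (b%:R - 1 + x) ^+ k.
  transitivity (\prod_(i < k) \sum_(y < b) (if f i == y then x else 1)).
    rewrite bigA_distr_bigA; apply: eq_bigr => g _.
    rewrite -prodr_const big_mkcond /=.
    by apply: eq_bigr => i _; rewrite inE.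
  rewrite -[in RHS](card_ord k) -prodr_const; apply: eq_bigr => i _.
  rewrite (bigD1 (f i)) //= eqxx addrC; congr (_ + _).
  rewrite (eq_bigr (fun=> 1)) => [|y yf]; last by rewrite eq_sym (negbTE yf).
  rewrite sumr_const cardC1 card_ord.
  by rewrite -[in RHS](ltn_predK (ltn_ord (f i))) -natr1 addrK.
under eq_bigr do rewrite inner.
by rewrite sumr_const card_ffun !card_ord -[LHS]mulr_natl natrX exprMn.
Qed.

(** By Bernoulli's inequality, [(1 - u) ^+ k >= 3 / 4], while
    [(1 + u) ^+ k * (1 - u) ^+ k <= 1]; so in fact [(1 + u) ^+ k <= 4 / 3]. *)
Lemma expr_1p_le (R : realType) (u : R) k :
  0 <= u -> k%:R * u <= 1 / 4 -> (1 + u) ^+ k <= 3 / 2.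
Proof.
move=> u0; case: k => [|k] ku; first by rewrite expr0; lra.
have u1 : u <= 1 / 4.
  by apply: le_trans ku; rewrite ler_peMl // ler1n.
have bernoulli m : 1 - m%:R * u <= (1 - u) ^+ m.
  elim: m => [|m IHm]; first by rewrite expr0; lra.
  rewrite exprS; apply: (@le_trans _ _ ((1 - u) * (1 - m%:R * u))).
    by rewrite -natr1; have := mulr_ge0 (ler0n R m) (sqr_ge0 u); lra.
  by rewrite ler_wpM2l //; lra.
have prod_le1 : (1 + u) ^+ k.+1 * (1 - u) ^+ k.+1 <= 1.
  by rewrite -exprMn exprn_ile1 //; nra.
have := bernoulli k.+1; have : 0 <= (1 + u) ^+ k.+1 by rewrite exprn_ge0; lra.
nra.
Qed.

(** [X] counts the transversal cliques and [mu] is its mean.  The size required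
    of the blocks makes [k * (2 ^ t / b)] at most [1 / 4], whence
    [E (X ^ 2) <= 3 / 2 * mu ^ 2], and the second moment inequality gives
    [Pr (X != 0) >= 2 - 3 / 2]. *)
Lemma Pr_transversal (R : realType) n t b (phi : 'I_t.*2.+1 * 'I_b -> 'I_n) :
  injective phi -> (t.*2.+1 * 2 ^ t.+2 <= b)%N ->
  1 / 2 <= gnp_Pr (1 / 2 : R) (fun G =>
    [exists f, is_clique G (transversal phi f)]).
Proof.
move=> phi_inj tb; set p : R := 1 / 2; set k := t.*2.+1; set m := 'C(k, 2).
have p01 : 0 <= p <= 1 by rewrite /p; lra.
pose T f := transversal phi f.
pose X (G : graph n) : R := \sum_f (pairs_in (T f) \subset G)%:R.
have cardS f : #|pairs_in (T f)| = m by rewrite card_pairs_in card_transversal.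
have b0 : 0 < b%:R :> R.
  by rewrite ltr0n; apply: leq_trans tb; rewrite muln_gt0 expn_gt0.
have EE (S : {set vpair n}) :
    \sum_G gnp_weight p G * (S \subset G)%:R = p ^+ #|S|.
  rewrite -gnp_Pr_supset /gnp_Pr big_mkcond [RHS]big_mkcond /=.
  by apply: eq_bigr => G _; case: ifP; rewrite ?mulr1 ?mulr0.
pose mu : R := b%:R ^+ k * p ^+ m.
have mu0 : 0 < mu by rewrite mulr_gt0 ?exprn_gt0 // /p; lra.
have EX : \sum_G gnp_weight p G * X G = mu.
  under eq_bigr do rewrite mulr_sumr.
  rewrite exchange_big /=; under eq_bigr do rewrite EE cardS.
  by rewrite sumr_const card_ffun !card_ord -[LHS]mulr_natl natrX.
have EX2 : \sum_G gnp_weight p G * X G ^+ 2 <= 3 / 2 * mu ^+ 2.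
  have -> : \sum_G gnp_weight p G * X G ^+ 2 =
      \sum_f \sum_g p ^+ #|pairs_in (T f) :|: pairs_in (T g)|.
    under eq_bigr do rewrite expr2 big_distrlr mulr_sumr /=.
    rewrite exchange_big /=; apply: eq_bigr => f _.
    under eq_bigr do rewrite mulr_sumr.
    rewrite exchange_big /=; apply: eq_bigr => g _.
    rewrite -EE; apply: eq_bigr => G _; congr (_ * _).
    by rewrite -natrM mulnb finset.subUset.
  (* The union of the two pair sets has 2m - 'C(a, 2) elements, where a is the
     number of blocks on which f and g agree. *)
  have le_fg f g : p ^+ #|pairs_in (T f) :|: pairs_in (T g)| <=
      p ^+ m ^+ 2 * (2 ^+ t) ^+ #|[set i | f i == g i]|.
    have agk : (#|[set i | f i == g i]| <= k)%N.
      by rewrite -[leqRHS]card_ord max_card.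
    have := cardsUI (pairs_in (T f)) (pairs_in (T g)).
    rewrite -pairs_inI [X in (_ + X)%N]card_pairs_in.
    rewrite card_transversalI // !cardS.
    move: (#|_ :|: _|) => u um.
    have p2 j : 2 ^+ j * p ^+ j = 1.
      by rewrite -exprMn (_ : 2 * p = 1) ?expr1n // /p; lra.
    rewrite -exprM -exprM muln2 -addnn -um exprD -mulrA ler_peMr //.
      by rewrite exprn_ge0 // /p; lra.
    rewrite -[leLHS](p2 'C(#|[set i | f i == g i]|, 2)) [leLHS]mulrC.
    rewrite ler_wpM2l //; first by rewrite exprn_ge0 // /p; lra.
    by rewrite ler_eXn2l ?bin2_half_le //; lra.
  apply: (@le_trans _ _ (p ^+ m ^+ 2 * (b%:R * (b%:R - 1 + 2 ^+ t)) ^+ k)).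
    rewrite -sum_agree mulr_sumr; apply: ler_sum => f _.
    by rewrite mulr_sumr; apply: ler_sum => g _; exact: le_fg.
  pose u : R := 2 ^+ t / b%:R.
  have u0 : 0 <= u by rewrite divr_ge0 ?exprn_ge0 // ltW.
  have ku : k%:R * u <= 1 / 4.
    rewrite /u mulrA ler_pdivrMr //.
    have : (t.*2.+1 * 2 ^ t.+2)%:R <= b%:R :> R by rewrite ler_nat.
    rewrite natrM natrX !exprS -/k; lra.
  have := expr_1p_le u0 ku.
  have -> : p ^+ m ^+ 2 * (b%:R * (b%:R - 1 + 2 ^+ t)) ^+ k =
     mu ^+ 2 * (1 + u - b%:R^-1) ^+ k.
    rewrite /mu [in RHS]exprMn [RHS]mulrAC [RHS]mulrC; congr (_ * _).
    rewrite [X in _ = X * _]exprAC -exprMn; congr (_ ^+ _); rewrite /u.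
    by field; rewrite gt_eqF.
  move=> h; rewrite [leLHS]mulrC ler_wpM2r ?sqr_ge0 //; apply: le_trans h.
  have b1 : b%:R^-1 <= 1 :> R.
    by rewrite invf_le1 // ler1n -(ltr0n R).
  have b1_gt0 : 0 < b%:R^-1 :> R by rewrite invr_gt0.
  by apply: lerXn2r; rewrite ?nnegrE; lra.
have := gnp_second_moment mu X p01; rewrite EX => sm.
have {sm} : mu ^+ 2 * (1 / 2) <= mu ^+ 2 * gnp_Pr p (fun G => X G != 0) by lra.
rewrite ler_pM2l ?exprn_gt0 // => h; apply: le_trans h _.
apply: gnp_Pr_mono => // G; apply: contraR => /existsPn none.
by rewrite /X big1 // => f _; move: (none f); rewrite is_cliqueE => /negbTE ->.
Qed.

(** * The algorithm that probes all pairs in a vertex set *)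

(** On a one-round transcript [head _ h] is the only round; the default value is
    used on the empty transcript only. *)
Definition clique_finder (n : nat) (W : {set 'I_n}) : algorithm n :=
  {| select := fun _ => pairs_in W;
     output := fun h => [arg max_(C > finset.set0 |
       is_clique (head (finset.set0, finset.set0) h).2 C) #|C|]%N |}.

Lemma clique_finder_spec n (W : {set 'I_n}) (G : graph n) :
  is_clique G (result (clique_finder W) 1 G) /\
  forall C : {set 'I_n}, C \subset W -> is_clique G C ->
    (#|C| <= #|result (clique_finder W) 1 G|)%N.
Proof.
rewrite /result /=; case: arg_maxnP => [|C CG Cmax].
  by apply/forallP => e; rewrite !finset.in_set0.
split=> [|D DW DG].
  by move: CG; rewrite !is_cliqueE finset.subsetI => /andP[].
apply: Cmax; move: DG; rewrite !is_cliqueE finset.subsetI => ->.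
by rewrite pairs_inS.
Qed.

Definition initial (n N : nat) : {set 'I_n} := [set v : 'I_n | (v < N)%N].

Lemma card_initial n N : (N <= n)%N -> #|initial n N| = N.
Proof.
move=> Nn; rewrite -sum1_card (eq_bigl (fun v : 'I_n => v < N)%N); last first.
  by move=> v; rewrite inE.
by rewrite (big_ord_narrow Nn) sum1_card card_ord.
Qed.

(** The blocks live on the first [N] vertices, so every transversal clique
    consists of probed pairs and competes in the maximization that produces the
    output. *)
Lemma clique_finder_lower (R : realType) n t b (N := (t.*2.+1 * b)%N)
    (A := clique_finder (initial n N)) :
  (t.*2.+1 * 2 ^ t.+2 <= b)%N -> (N <= n)%N ->
  (forall G, (num_probes A 1 G <= N ^ 2)%N) /\
  1 / 2 <= gnp_Pr (1 / 2 : R) (fun G => (t.*2.+1 <= #|result A 1 G|)%N).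
Proof.
move=> tb Nn; split=> [G|].
  rewrite num_probes1 /= card_pairs_in card_initial // bin2.
  rewrite -mulnn leq_half_double; apply: leq_trans (_ : N * N <= _)%N; last lia.
  by rewrite leq_mul2l leq_pred orbT.
have Ncard : #|{: 'I_t.*2.+1 * 'I_b}| = N by rewrite card_prod !card_ord.
pose phi x : 'I_n := widen_ord Nn (cast_ord Ncard (enum_rank x)).
have phi_inj : injective phi.
  by move=> x y /(congr1 val) /= /val_inj /enum_rank_inj.
apply: le_trans (Pr_transversal R phi_inj tb) _.
apply: gnp_Pr_mono => [|G /existsP[f fG]]; first by lra.
rewrite -(card_transversal f phi_inj).
apply: (clique_finder_spec _ G).2 fG.
apply/fintype.subsetP => v /imsetP[i _ ->]; rewrite inE /=.
by rewrite -[ltnRHS]Ncard.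
Qed.

(** * Asymptotics *)

Local Open Scope classical_set_scope.
Local Open Scope ring_scope.

Lemma near_ln_ge (R : realType) (K : R) : \forall n \near \oo, K <= ln n%:R.
Proof.
have [n0 _ h] := nbhs_infty_ger (expR K).
exists n0 => // n /= /h nK.
by rewrite -(expRK K) ler_ln ?posrE ?expR_gt0 // (lt_le_trans (expR_gt0 _) nK).
Qed.

Lemma exp2E (R : realType) t : 2 ^+ t = expR (t%:R * ln 2) :> R.
Proof. by rewrite expRM_natl lnK // posrE. Qed.

Lemma natpowE (R : realType) n (x : R) :
  (0 < n)%N -> n%:R `^ x = expR (x * ln n%:R).
Proof. by move=> n0; rewrite /powR pnatr_eq0 gtn_eqF. Qed.

(** With [2t] the largest even integer not exceeding [alpha * log n], one has
    [2 ^ (2t + 2) >= n ^ alpha], which exceeds [32 * n ^ delta] once [n] is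
    large. *)
Lemma not_achievable (R : realType) (delta alpha : R) :
  0 <= delta -> delta < alpha -> ~ achievable delta 1 alpha.
Proof.
move=> d0 da [A [sureA good]].
have ln2 : 0 < ln 2 :> R by rewrite ln_gt0 // ltr1n.
have a0 : 0 < alpha by lra.
(* The first bound on ln n gives n ^ (alpha - delta) >= 32, the second one
   gives t >= 1. *)
have [n [[probes half] L1 L2 n0]] : exists n : nat,
  [/\ (forall G, (num_probes (A n) 1 G)%:R <= n%:R `^ delta) /\
      1 / 2 <= gnp_Pr (1 / 2 : R)
        (fun G => alpha * log2 (n%:R : R) <= #|result (A n) 1 G|%:R),
      32 / (alpha - delta) <= ln n%:R :> R,
      2 * ln 2 / alpha <= ln n%:R :> R & (0 < n)%N].
  near \oo => n; exists n; split.
  - by near: n; exact: good.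
  - by near: n; exact: near_ln_ge.
  - by near: n; exact: near_ln_ge.
  - by near: n; exact: nbhs_infty_gt.
set L : R := ln n%:R in L1 L2 *.
set E := select (A n) [::].
have EL : #|E|%:R <= expR (delta * L).
  by rewrite -natpowE // -(num_probes1 (A n) finset.set0).
pose s : R := alpha * log2 (n%:R : R).
have s0 : 0 <= s / 2.
  have L0 : 0 <= L by apply: le_trans L2; rewrite divr_ge0 ?mulr_ge0 // ltW.
  by rewrite /s /log2 -/L !(mulr_ge0, invr_ge0) // ltW.
pose t := Num.truncn (s / 2).
have /andP[ts st] : t%:R <= s / 2 < t.+1%:R by exact: truncn_itv.
have t1 : (0 < t)%N.
  rewrite truncn_gt0 /s /log2 -/L mulrA ler_pdivlMr // ler_pdivlMr //.
  by rewrite mul1r [leRHS]mulrC -ler_pdivrMr.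
have expt : expR (alpha * L) <= 2 ^+ (t.*2.+2).
  rewrite exp2E ler_expR.
  have -> : alpha * L = s * ln 2 by rewrite /s /log2 -/L mulrA divfK // gt_eqF.
  rewrite ler_pM2r //.
  by move: st; rewrite -doubleS -muln2 natrM; lra.
have few : #|E|%:R * 32 <= 2 ^+ t.*2.+2 :> R.
  apply: le_trans expt.
  rewrite (_ : alpha * L = delta * L + (alpha - delta) * L); last by ring.
  rewrite expRD ler_pM //; apply: le_trans (expR_ge1Dx _).
  by move: L1; rewrite ler_pdivrMr ?subr_gt0 // => L1; lra.
have : gnp_Pr (1 / 2 : R) (fun G => s <= #|result (A n) 1 G|%:R) <= 1 / 4.
  apply: le_trans (Pr_clique_upper_half t1 few).
  apply: gnp_Pr_mono => [|G sG]; first exact: half01.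
  apply/existsP; exists (result (A n) 1 G).
  rewrite is_clique_probed // -(ler_nat R); apply: le_trans sG.
  by rewrite -muln2 natrM -ler_pdivlMr.
by move=> /(le_trans half); rewrite leNgt => /negP[]; clear; lra.
Unshelve. all: by end_near.
Qed.

(** The cubic term of the exponential series suffices: the hypothesis on [L],
    multiplied by [L ^+ 2], gives [8 * (c * L) ^+ 2 <= (g * L) ^+ 3 / 3!]. *)
Lemma quadratic_le_expR (R : realType) (c g L : R) :
  0 < g -> 0 <= L -> 48 * c ^+ 2 / g ^+ 3 <= L ->
  8 * (c * L) ^+ 2 <= expR (g * L).
Proof.
move=> g0 L0; rewrite ler_pdivrMr ?exprn_gt0 // => /(ler_wpM2r (sqr_ge0 L)) LK.
apply: le_trans (_ : _ <= 1 + (g * L) ^+ 3 / 3`!%:R) _; last first.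
  by apply: expR_ge1Dxn; rewrite mulr_ge0 // ltW.
rewrite (_ : 3`!%:R = 6 :> R) //.
have : 8 * (c * L) ^+ 2 <= (g * L) ^+ 3 / 6; last by lra.
by rewrite ler_pdivlMr //; lra.
Qed.

(** With [t] the least integer exceeding [alpha * log n / 2], the number [N n]
    of vertices used is [4 * k ^ 2 * 2 ^ t], where [k = 2t + 1] is at most
    [c * ln n] and [2 ^ t] at most [2 * n ^ (alpha / 2)].  The room left by
    [g = (delta - alpha) / 2] absorbs the factor [8 * (c * ln n) ^ 2]. *)
Lemma achievable_lt (R : realType) (delta alpha : R) :
  delta <= 2 -> 0 < alpha -> alpha < delta -> achievable delta 1 alpha.
Proof.
move=> d2 a0 ad.
have ln2 : 0 < ln 2 :> R by rewrite ln_gt0 // ltr1n.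
pose s (n : nat) : R := alpha * log2 (n%:R : R).
pose t n := (Num.truncn (s n / 2)).+1.
pose b n := ((t n).*2.+1 * 2 ^ (t n).+2)%N.
pose N n := ((t n).*2.+1 * b n)%N.
exists (fun n => clique_finder (initial n (N n))); split.
  by move=> n G; exact: (clique_finder_spec _ G).1.
pose c := alpha / ln 2 + 3.
pose g := (delta - alpha) / 2.
near=> n.
have n0 : (0 < n)%N by near: n; exact: nbhs_infty_gt.
have L1 : 1 <= ln n%:R :> R by near: n; exact: near_ln_ge.
have LK : 48 * c ^+ 2 / g ^+ 3 <= ln n%:R by near: n; exact: near_ln_ge.
set L : R := ln n%:R in L1 LK *.
have L0 : 0 <= L := le_trans ler01 L1.
have g0 : 0 < g by rewrite /g; lra.
have c0 : 0 < c by rewrite /c addr_gt0 // divr_gt0.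
have sL : s n * ln 2 = alpha * L by rewrite /s /log2 -/L mulrA divfK // gt_eqF.
have s0 : 0 <= s n.
  by rewrite -(@pmulr_lge0 _ (ln 2)) // sL mulr_ge0 // ltW.
have /andP[ts st] : (t n).-1%:R <= s n / 2 < (t n)%:R.
  by apply: truncn_itv; lra.
have kc : (t n).*2.+1%:R <= c * L.
  have -> : (t n).*2.+1%:R = 2 * (t n).-1%:R + 3 :> R.
    by rewrite /t /= doubleS -muln2 -!natr1 natrM; ring.
  have -> : c * L = s n + 3 * L.
    by rewrite /c mulrDl mulrAC -sL; field; lra.
  lra.
have pow2 : 2 ^+ t n <= 2 * expR (alpha / 2 * L).
  rewrite /t exprS ler_wpM2l // exp2E ler_expR.
  by rewrite [leRHS]mulrAC -sL [leRHS]mulrAC ler_pM2r.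
have NL : (N n)%:R <= expR (delta / 2 * L).
  have -> : (N n)%:R = (t n).*2.+1%:R ^+ 2 * (4 * 2 ^+ t n) :> R.
    rewrite /N /b; move: (t n) (_.*2.+1) => j k.
    by rewrite 2!natrM natrX !exprS; ring.
  apply: (@le_trans _ _ ((c * L) ^+ 2 * (4 * (2 * expR (alpha / 2 * L))))).
    apply: ler_pM; rewrite ?sqr_ge0 ?mulr_ge0 ?exprn_ge0 //.
      by rewrite lerXn2r ?nnegrE // (le_trans _ kc).
    by rewrite ler_wpM2l.
  have -> : delta / 2 * L = g * L + alpha / 2 * L by rewrite /g; ring.
  rewrite expRD !mulrA ler_wpM2r ?expR_ge0 //.
  have -> : (c * L) ^+ 2 * 4 * 2 = 8 * (c * L) ^+ 2 by ring.
  exact: quadratic_le_expR.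
have Nn : (N n <= n)%N.
  rewrite -(ler_nat R); apply: le_trans NL _.
  rewrite -[leRHS](@lnK R) ?posrE ?ltr0n // ler_expR -/L.
  by rewrite ler_piMl // ler_pdivrMr // mul1r.
have [probes Pr] := clique_finder_lower R (leqnn (b n)) Nn.
split=> [G|].
  rewrite natpowE // -/L.
  rewrite (_ : delta * L = delta / 2 * L + delta / 2 * L); last by field.
  rewrite expRD; apply: (@le_trans _ _ (N n ^ 2)%:R); first by rewrite ler_nat.
  by rewrite natrX expr2 ler_pM.
apply: le_trans Pr _; apply: gnp_Pr_mono => [|G kG]; first exact: half01.
apply: (@le_trans _ _ ((t n).*2)%:R); last by rewrite ler_nat ltnW.
by rewrite -muln2 natrM -ler_pdivrMr // ltW.
Unshelve. all: by end_near.
Qed.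

Theorem lemma4 (R : realType) (delta : R)
    (delta_ge1 : 1 <= delta) (delta_lt2 : delta < 2) :
  alpha_star delta 1%N = delta%:E.
Proof.
apply/eqP; rewrite eq_le; apply/andP; split.
  apply: ge_ereal_sup => _ [a ach <-]; rewrite lee_fin leNgt; apply/negP => da.
  by apply: (not_achievable _ da ach); lra.
(* The maximum with 1/2 keeps the constant positive when e is large. *)
apply/lee_addgt0Pr => e e0; rewrite -leeBlDr //.
pose a := Num.max (delta - e) (1 / 2).
have [ae a0 ad] : [/\ delta - e <= a, 0 < a & a < delta].
  by rewrite /a lt_max gt_max le_max lexx; split => //; lra.
apply: le_ereal_sup_tmp; exists a%:E; last by rewrite lee_fin.
by exists a => //; apply: achievable_lt => //; exact: ltW.
Qed.
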